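(* Let $X, X_1,X_2,\dots$ be i.i.d. nonnegative random variables with finite expectation and $\mathrm{P}(X=0)<1$. Then for all $t>0$, $$\frac{M(t)}{V(t)}<2-\frac{1-e^{-t}}{t}.$$
   Context: Let $S_1<S_2<\cdots$ be the arrival times of a homogeneous Poisson process with rate $\lambda=1$ on $(0,\infty)$, independent of the sequence $X_1,X_2,\dots$; the value $X_k$ is observed at time $S_k$. Let $N(t)$ be the number of arrivals up to time $t$, i.e. $N(t)=\max\{k\ge 0: S_k\le t\}$ with $S_0=0$. Define $$M(t):=\mathrm{E}\big(\max\{X_1,\dots,X_{N(t)}\}\big),$$ where the maximum of an empty set is taken to be $0$, and $$V(t):=\sup_{\tau\in\mathcal{T}}\mathrm{E}\big[X_\tau\,\mathrm{I}(S_\tau\le t)\big],$$ where $\mathrm{I}$ denotes an indicator and $\mathcal{T}$ is the set of all $\mathbb{N}$-valued random variables (stopping rules) $\tau$ such that, for each $i$, the event $\{\tau=i\}$ is measurable with respect to the $\sigma$-algebra generated by $(X_1,S_1),\dots,(X_i,S_i)$. *)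

(* Defs.v *)
From HB Require Import structures.
From mathcomp Require Import all_boot all_order all_algebra finmap.
From mathcomp Require Import all_classical all_reals all_analysis.

Set Implicit Arguments.
Unset Strict Implicit.
Unset Printing Implicit Defensive.

Import Order.TTheory GRing.Theory Num.Theory.

Local Open Scope classical_set_scope.
Local Open Scope ring_scope.

(* The sequences X and S below are 1-based, as in X_1, X_2, ... : the term of
   index 0 is S_0 = 0 for arrival times, and is never used for observations. *)

Section independence.
Context d (T : measurableType d) (R : realType) (P : probability T R).
Context d' (U : measurableType d').

Definition mutually_independent (I : choiceType) (D : set I)
    (f : I -> T -> U) : Prop :=
  forall (J : {fset I}) (B : I -> set U),
    [set` J] `<=` D -> (forall i, measurable (B i)) ->
    P (\bigcap_(i in [set` J]) (f i @^-1` B i)) =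
    (\prod_(i <- J) P (f i @^-1` B i))%E.

Definition generated_sigma_algebra (I : Type) (D : set I)
    (f : I -> T -> U) : set (set T) :=
  <<s \bigcup_(i in D) preimage_set_system setT (f i) measurable >>.

Definition independent_classes (F G : set (set T)) : Prop :=
  forall A B, F A -> G B -> P (A `&` B) = (P A * P B)%E.

End independence.

Section random_arrivals.
Context d (T : measurableType d) (R : realType) (P : probability T R).
Implicit Types (X S : nat -> {RV P >-> R}) (t : R).

Definition positive_indices : set nat := [set k | (0 < k)%N].

(* The k realizing max {k >= 0 : S_k <= t}. The default value 0 of xget is only
   used where that maximum does not exist, which is a null event for the
   arrival times of a Poisson process. *)
Definition arrival_count S t (w : T) : nat :=
  xget 0%N [set k | S k w <= t /\ forall j, S j w <= t -> (j <= k)%N].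

(* The difference of counts is a truncated subtraction, but counts are
   almost surely nondecreasing in time by the first clause. *)
Definition poisson_arrivals (lambda : R) S : Prop :=
  [/\ {ae P, forall w, [/\ S 0%N w = 0,
         forall k, S k w < S k.+1 w &
         forall t, exists k, t < S k w]},
      forall u : nat -> R, 0 <= u 0%N -> (forall i, u i <= u i.+1) ->
        mutually_independent P setT
          (fun i w => (arrival_count S (u i.+1) w - arrival_count S (u i) w)%N)
    & forall s t n, 0 <= s -> s < t ->
        P [set w | (arrival_count S t w - arrival_count S s w)%N = n] =
        (poisson_pmf (lambda * (t - s)) n)%:E].

Definition prophet_value X S t : \bar R :=
  ('E_P[(fun w => \big[Num.max/0]_(1 <= k < (arrival_count S t w).+1)
                    X k w)%R])%E.

Definition stopping_rule X S (tau : T -> nat) : Prop :=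
  (forall w, (0 < tau w)%N) /\
  (forall i, (0 < i)%N ->
     generated_sigma_algebra [set j | (1 <= j <= i)%N]
       (fun j w => (X j w, S j w)) [set w | tau w = i]).

Definition optimal_stopping_value X S t : \bar R :=
  ereal_sup [set ('E_P[(fun w => X (tau w) w *
                             \1_[set w' | S (tau w') w' <= t] w)%R])%E
            | tau in stopping_rule X S].

End random_arrivals.

(* Main.v *)
(* A single threshold suffices. Put V := V(t), q := (1 - e^-t)/t,
   k := 1/(1 - e^-t) - 1/t and c := k V, and let p := P(X > c),
   e := E(X - c)^+. Stopping at the first X_j > c earns
   (e + c p)(1 - e^(-pt))/p <= V. The function x/(1 - e^-x) is convex and equals
   1 at x = 0, so its chord on [0, t] gives p/(1 - e^(-pt)) <= 1/t + p k, hence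
   e + c p <= V/t + c p, that is t e <= V.
   On the other hand X_1, ..., X_n have maximum at most
   c 1(n >= 1) + \sum_j (X_j - c)^+, so M(t) <= c (1 - e^-t) + t e, and
   c (1 - e^-t) = (1 - q) V. Therefore M(t) <= (2 - q) V. The sum overcounts as
   soon as X_1 and X_2 both exceed c and arrive by time t, which makes the
   inequality strict when p > 0; when p = 0 already M(t) <= (1 - q) V. *)
Require Import Defs.
From mathcomp Require Import all_boot all_order all_algebra finmap.
From mathcomp Require Import all_classical all_reals all_analysis.
From mathcomp Require Import measurable_realfun.
From mathcomp Require Import ring lra zify.

Set Implicit Arguments.
Unset Strict Implicit.
Unset Printing Implicit Defensive.

Import Order.TTheory GRing.Theory Num.Theory.
Import numFieldNormedType.Exports.

Local Open Scope classical_set_scope.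
Local Open Scope ring_scope.

(** * The chord inequality for [x / (1 - exp (- x))] *)

(** The difference of the two sides vanishes at 0 and has derivative (e^y - 1)^2 / e^y, which is
    nonnegative. *)
Lemma double_le_expRB (R : realType) (x : R) :
  0 < x -> x * 2 <= expR x - expR (- x).
Proof.
move=> x0.
pose f (y : R) := expR y - expR (- y) - y * 2.
have df (y : R) : is_derive y 1 f (expR y + expR (- y) - 2).
  by apply: is_derive_eq; rewrite /GRing.scale/=; ring.
have : f 0 <= f x.
  apply: (@ger0_derive1_ndecry _ f 0) => //; last exact: ltW.
  - move=> y _; rewrite derive1E derive_val expRN.
    have e0 := expR_gt0 y.
    have -> : expR y + (expR y)^-1 - 2 = (expR y - 1) ^+ 2 / expR y.
      by field; rewrite gt_eqF.
    by rewrite divr_ge0 ?sqr_ge0 ?ltW.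
  - apply: continuous_subspaceT => y; apply: differentiable_continuous.
    by apply/derivable1_diffP; have D := @ex_derive _ _ _ _ _ _ _ (df y); exact: D.
by rewrite /f oppr0 expR0; lra.
Qed.

(** The preceding bound at x/2, multiplied by e^(-x/2) and squared; it gives the sign of the
    derivative in the next lemma. *)
Lemma sqr_expRN_le (R : realType) (x : R) :
  0 < x -> x ^+ 2 * expR (- x) <= (1 - expR (- x)) ^+ 2.
Proof.
move=> x0.
have h0 : 0 < x / 2 by rewrite divr_gt0.
have := double_le_expRB h0.
rewrite divfK ?pnatr_eq0 // => H.
have e2 : expR (- x) = expR (- (x / 2)) ^+ 2.
  by rewrite expr2 -expRD; congr expR; field.
have ei : expR (x / 2) * expR (- (x / 2)) = 1 by rewrite expRxMexpNx_1.
have := expR_gt0 (- (x / 2)).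
move: ei H e2; move: (expR (x / 2)) (expR (- (x / 2))) => a b ab H -> b0.
have -> : x ^+ 2 * b ^+ 2 = (x * b) ^+ 2 by rewrite exprMn.
have -> : 1 - b ^+ 2 = (a - b) * b by rewrite mulrBl ab expr2.
have b0' := ltW b0.
by rewrite ler_sqr ?nnegrE ?mulr_ge0 ?ler_wpM2r //; lra.
Qed.

(** With f(x) = x/(1 - e^-x) and f(0) = 1, the expression is the chord slope (f(x) - f(0))/x; its
    monotonicity is the part of convexity that is used. *)
Lemma inv_onem_expRN_sub_inv_le (R : realType) (x y : R) : 0 < x -> x <= y ->
  (1 - expR (- x))^-1 - x^-1 <= (1 - expR (- y))^-1 - y^-1.
Proof.
move=> x0 xy.
pose f (y : R) := (1 - expR (- y))^-1 - y^-1.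
have pos (z : R) : 0 < z -> 0 < 1 - expR (- z).
  by move=> z0; rewrite subr_gt0 expR_lt1 oppr_lt0.
have df (z : R) : 0 < z -> is_derive z 1 f
    (- (1 - expR (- z)) ^- 2 * expR (- z) + z ^- 2).
  move=> z0; have e0 := pos z z0.
  have d1 : is_derive z 1 (fun z : R => 1 - expR (- z)) (expR (- z)).
    by apply: is_derive_eq; rewrite /GRing.scale/=; ring.
  have d2 := @is_deriveV R (fun z : R => 1 - expR (- z)) z _ 1 (lt0r_neq0 e0) d1.
  have d3 := @is_deriveV R id z _ 1 (lt0r_neq0 z0) (is_derive_id z 1).
  have d4 := is_deriveB d2 d3.
  by apply: (is_derive_eq d4); rewrite /GRing.scale/=; ring.
apply: (@ger0_derive1_ndecr _ f x y) => //.
- move=> z /[!in_itv]/= /andP[xz _].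
  have D := @ex_derive _ _ _ _ _ _ _ (df z (lt_trans x0 xz)); exact: D.
- move=> z /[!in_itv]/= /andP[xz _]; have z0 := lt_trans x0 xz.
  have dz := df z z0.
  rewrite derive1E derive_val addrC mulNr subr_ge0 mulrC ler_pdivrMr ?exprn_gt0 ?pos //.
  rewrite mulrC ler_pdivlMr ?exprn_gt0 // mulrC.
  exact: sqr_expRN_le.
- apply: derivable_within_continuous => z /[!in_itv]/= /andP[xz _].
  have D := @ex_derive _ _ _ _ _ _ _ (df z (lt_le_trans x0 xz)); exact: D.
Qed.

(** The chord slopes at pt and at t are compared, then multiplied by p. *)
Lemma div_onem_expRN_le (R : realType) (p t : R) : 0 < p <= 1 -> 0 < t ->
  p / (1 - expR (- (p * t))) <= t^-1 + p * ((1 - expR (- t))^-1 - t^-1).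
Proof.
move=> /andP[p0 p1] t0.
have pt0 : 0 < p * t by rewrite mulr_gt0.
have ptt : p * t <= t by rewrite ger_pMl.
have := inv_onem_expRN_sub_inv_le pt0 ptt; rewrite -(ler_pM2l p0).
rewrite mulrBr invfM mulrA divff ?gt_eqF // mul1r; lra.
Qed.

(** * Poisson tails *)

(** For t > 0, the probability that a Poisson variable N of mean t is at least k, hence also that of
    S_k <= t. *)
Definition poisson_tail (R : realType) (t : R) (k : nat) : R :=
  1 - \sum_(n < k) poisson_pmf t n.

Section poisson_tail.
Context {R : realType}.
Variables (t : R) (t_gt0 : 0 < t).
Implicit Types (z : R) (k n : nat).

Let poisson_pmfE n : poisson_pmf t n = expR (- t) * exp_coeff t n.
Proof. by rewrite /poisson_pmf t_gt0 mulrC. Qed.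

Lemma poisson_tail0 : poisson_tail t 0 = 1.
Proof. by rewrite /poisson_tail big_ord0 subr0. Qed.

Lemma poisson_tailS k : poisson_tail t k.+1 = poisson_tail t k - poisson_pmf t k.
Proof. by rewrite /poisson_tail big_ord_recr /= opprD addrA. Qed.

Lemma poisson_tail1 : poisson_tail t 1 = 1 - expR (- t).
Proof.
rewrite poisson_tailS poisson_tail0 poisson_pmfE /exp_coeff /=.
by rewrite fact0 expr0 divr1 mulr1.
Qed.

Lemma poisson_pmf_succ n : n.+1%:R * poisson_pmf t n.+1 = t * poisson_pmf t n.
Proof.
rewrite !poisson_pmfE /exp_coeff /= exprS factS natrM; field.
by rewrite nat1r !pnatr_eq0 -lt0n fact_gt0.
Qed.

(** The probability generating function of the Poisson law; z = 1 gives total mass 1. *)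
Lemma cvg_sum_poisson_pmf z :
  \sum_(n < k) z ^+ n * poisson_pmf t n @[k --> \oo] --> expR (- ((1 - z) * t)).
Proof.
have -> : expR (- ((1 - z) * t)) = expR (- t) * expR (z * t).
  by rewrite -expRD; congr expR; ring.
have -> : (fun k => \sum_(n < k) z ^+ n * poisson_pmf t n) =
          (fun k => expR (- t) * series (exp_coeff (z * t)) k).
  apply/funext => k; rewrite /series/= mulr_sumr big_mkord.
  by apply: eq_bigr => i _; rewrite poisson_pmfE /exp_coeff /= exprMn; ring.
by apply: cvgMl_tmp; exact: is_cvg_series_exp_coeff.
Qed.

Lemma cvg_poisson_tail : poisson_tail t k @[k --> \oo] --> 0.
Proof.
rewrite -(subrr 1); apply: cvgB; first exact: cvg_cst.
have := @cvg_sum_poisson_pmf 1; rewrite subrr mul0r oppr0 expR0.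
by under eq_fun do under eq_bigr do rewrite expr1n mul1r.
Qed.

Lemma nonincreasing_poisson_tail : nonincreasing_seq (poisson_tail t).
Proof.
apply/nonincreasing_seqP => k.
by rewrite poisson_tailS gerBl poisson_pmf_ge0.
Qed.

Lemma poisson_tail_ge0 k : 0 <= poisson_tail t k.
Proof.
rewrite -(cvg_lim (@Rhausdorff R) cvg_poisson_tail).
apply: nonincreasing_cvgn_ge; first exact: nonincreasing_poisson_tail.
exact: cvgP cvg_poisson_tail.
Qed.

Lemma poisson_tail_gt0 k : 0 < poisson_tail t k.
Proof.
apply: le_lt_trans (poisson_tail_ge0 k.+1) _.
rewrite poisson_tailS gtrBl poisson_pmfE mulr_gt0 ?expR_gt0 //.
by rewrite divr_gt0 ?exprn_gt0 ?ltr0n ?fact_gt0.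
Qed.

(** Summation by parts in finite form, the bridge from the generating function to sums of tails. *)
Lemma sum_poisson_tail_geometric z k :
  (1 - z) * \sum_(i < k) z ^+ i * poisson_tail t i.+1 =
  1 - \sum_(n < k) z ^+ n * poisson_pmf t n - z ^+ k * poisson_tail t k.
Proof.
elim: k => [|k IH]; first by rewrite !big_ord0 poisson_tail0; ring.
by rewrite !big_ord_recr /= mulrDr IH !poisson_tailS exprS; ring.
Qed.

(** For z = 1 - p, with p the chance that a mark exceeds the threshold, the limit is the factor (1 -
    e^(-pt))/p in the value of a threshold rule. *)
Lemma cvg_sum_poisson_tail z : 0 <= z < 1 ->
  \sum_(i < k) z ^+ i * poisson_tail t i.+1 @[k --> \oo] -->
  (1 - expR (- ((1 - z) * t))) / (1 - z).
Proof.
move=> /andP[z0 z1].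
have z1' : 1 - z != 0 by rewrite subr_eq0 eq_sym lt_eqF.
have -> : (fun k => \sum_(i < k) z ^+ i * poisson_tail t i.+1) =
  (fun k => (1 - \sum_(n < k) z ^+ n * poisson_pmf t n
             - z ^+ k * poisson_tail t k) / (1 - z)).
  apply/funext => k; rewrite -sum_poisson_tail_geometric.
  by rewrite mulrAC divff // mul1r.
apply: cvgMr_tmp.
rewrite -[X in _ --> X]subr0; apply: cvgB.
  by apply: cvgB; [exact: cvg_cst|exact: cvg_sum_poisson_pmf].
rewrite -(mulr0 0); apply: cvgM; last exact: cvg_poisson_tail.
by apply: cvg_expr; rewrite ger0_norm.
Qed.

(** By [poisson_pmf_succ], t P(N >= k) is the sum of (n + 1) P(N = n + 1) over n >= k, and each
    factor n + 1 is at least k + 1. *)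
Lemma mul_poisson_tailS_le k : k.+1%:R * poisson_tail t k.+1 <= t * poisson_tail t k.
Proof.
(* [u n] is the difference of the two sides with both sums cut to n terms; its increments are
   nonnegative and its limit is the claimed difference. *)
pose u n := t * (poisson_tail t k - poisson_tail t (k + n))
   - k.+1%:R * (poisson_tail t k.+1 - poisson_tail t (k.+1 + n)).
have u_ge0 n : 0 <= u n.
  rewrite /u; elim: n => [|n IH]; first by rewrite !addn0 !subrr !mulr0 subrr.
  apply: (le_trans IH).
  have -> : poisson_tail t (k + n.+1) = poisson_tail t (k + n) - poisson_pmf t (k + n).
    by rewrite addnS poisson_tailS.
  have -> : poisson_tail t (k.+1 + n.+1) =
      poisson_tail t (k.+1 + n) - poisson_pmf t (k + n).+1.
    by rewrite addnS poisson_tailS.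
  have : k.+1%:R * poisson_pmf t (k + n).+1 <= (k + n).+1%:R * poisson_pmf t (k + n).+1.
    by rewrite ler_wpM2r ?poisson_pmf_ge0 // ler_nat ltnS leq_addr.
  rewrite poisson_pmf_succ; lra.
have : u n @[n --> \oo] -->
    t * (poisson_tail t k - 0) - k.+1%:R * (poisson_tail t k.+1 - 0).
  apply: cvgB; apply: cvgMl_tmp; apply: cvgB; try exact: cvg_cst.
    have := cvg_poisson_tail; rewrite -(cvg_shiftn k).
    by under eq_fun do rewrite addnC.
  have := cvg_poisson_tail; rewrite -(cvg_shiftn k.+1).
  by under eq_fun do rewrite addnC.
rewrite !subr0 -subr_ge0 => cu.
by apply: (cvgr_to_ge cu); exact: nearW.
Qed.

(** Both sides are the mean of min(N, k + 1); the first term on the right comes from N <= k. *)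
Lemma sum_poisson_tail k : \sum_(i < k.+1) poisson_tail t i.+1 =
  t * (1 - poisson_tail t k) + k.+1%:R * poisson_tail t k.+1.
Proof.
elim: k => [|k IH]; first by rewrite big_ord1 poisson_tail0; ring.
rewrite big_ord_recr /= IH (poisson_tailS k.+1) poisson_tailS.
have := poisson_pmf_succ k; lra.
Qed.

Lemma sum_poisson_tail_le k : \sum_(i < k) poisson_tail t i.+1 <= t.
Proof.
case: k => [|k]; first by rewrite big_ord0 ltW.
by rewrite sum_poisson_tail; have := mul_poisson_tailS_le k; lra.
Qed.

End poisson_tail.

(** * Integrals and independence *)

Section nonneg_integral.
Context d (T : measurableType d) (R : realType) (P : {measure set T -> \bar R}).
Local Open Scope ereal_scope.

(** The integral is a supremum over simple functions below the integrand. This form serves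
    integrands whose measurability is not established, such as the reward of a stopping rule. *)
Lemma ge0_le_integral_nonmeasurable (f g : T -> \bar R) :
  (forall w, 0 <= f w) -> (forall w, f w <= g w) ->
  \int[P]_w f w <= \int[P]_w g w.
Proof.
move=> f0 fg; have g0 w : 0 <= g w by exact: le_trans (f0 w) (fg w).
rewrite !ge0_integralTE //; apply: le_ereal_sup => _ [h hf <-].
by exists h => // w; exact: le_trans (hf w) (fg w).
Qed.

(* f need not be measurable: adding +oo to g on the null set dominates it. *)
Lemma ge0_ae_le_integral (f g : T -> \bar R) :
  (forall w, 0 <= f w) -> (forall w, 0 <= g w) -> measurable_fun setT g ->
  {ae P, forall w, f w <= g w} -> \int[P]_w f w <= \int[P]_w g w.
Proof.
move=> f0 g0 mg [N [mN PN0 fgN]].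
pose h w := g w + ((cst +oo) \_ N) w.
have hN0 w : 0 <= ((cst +oo : T -> \bar R) \_ N) w.
  by rewrite patchE; case: ifP; rewrite /= ?le0y.
have -> : \int[P]_w g w = \int[P]_w h w.
  rewrite ge0_integralD //; last first.
    by apply/(measurable_restrictT _ _).1 => //; exact: measurable_cst.
  rewrite -integral_mkcond integral_cst //.
  by rewrite PN0 mule0 adde0.
apply: ge0_le_integral_nonmeasurable => // w; rewrite /h patchE.
case: ifPn => [_|wN]; first by rewrite addey ?leey // -ltNye (lt_le_trans _ (g0 w)).
rewrite adde0; apply: contrapT => fgw; move/negP: wN; apply; rewrite inE.
exact: fgN.
Qed.

End nonneg_integral.

Section independent_integral.
Context d (T : measurableType d) (R : realType) (P : probability T R).
Local Open Scope ereal_scope.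

(** [P] is the sum of its restrictions to [A] and to the complement. Against the second, [f \_ A]
    integrates to 0; against the first it agrees with [f] up to a null set. *)
Let integral_mrestr (A : set T) (mA : measurable A) (f : T -> \bar R) :
  measurable_fun setT f -> (forall w, 0 <= f w) ->
  \int[mrestr P mA]_w f w = \int[P]_(w in A) f w.
Proof.
move=> mf f0.
have mC := measurableC mA.
have mfA : measurable_fun setT (f \_ A).
  by apply/(measurable_restrictT _ _).1 => //; exact: measurable_funTS.
have fA0 w : 0 <= (f \_ A) w by rewrite patchE; case: ifP.
rewrite [RHS]integral_mkcond.
rewrite (eq_measure_integral (measure_add (mrestr P mA) (mrestr P mC))); last first.
  move=> B mB _.
  apply/esym; etransitivity; first exact: measure_addE.
  rewrite /= /mrestr -measureU.
  - by rewrite -setIUr setUCr setIT.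
  - exact: measurableI.
  - exact: measurableI.
  - by rewrite setIACA setICr setI0.
rewrite ge0_integral_measure_add //.
have mA0 : mrestr P mA (~` A) = 0 by rewrite /mrestr setICl measure0.
have mC0 : mrestr P mC A = 0 by rewrite /mrestr setICr measure0.
rewrite [X in _ + X](ge0_negligible_integral mA) //.
rewrite [X in _ + X]integral0_eq ?adde0; last first.
  by move=> w [_ wA]; rewrite patchE; case: ifPn => //; rewrite inE.
rewrite [LHS](ge0_negligible_integral mC) // [RHS](ge0_negligible_integral mC) //.
by apply: eq_integral => w; rewrite inE => -[_ /contrapT wA]; rewrite patchE mem_set.
Qed.

(** By independence, the law of [Y] under [P] restricted to [A] is [P A] times its law under [P];
    the rest is a change of variables. *)
Lemma ge0_integral_indep (A : set T) (Y : {RV P >-> R}) (g : R -> \bar R) :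
  measurable A -> measurable_fun setT g -> (forall x, 0 <= g x) ->
  (forall B, measurable B -> P (A `&` Y @^-1` B) = P A * P (Y @^-1` B)) ->
  \int[P]_(w in A) g (Y w) = P A * \int[P]_w g (Y w).
Proof.
move=> mA mg g0 AY.
have mY : measurable_fun setT (Y : T -> R) by [].
have mgY : measurable_fun setT (fun w => g (Y w)) by exact: measurableT_comp.
rewrite -integral_mrestr //.
have PA0 : (0 <= fine (P A))%R by rewrite fine_ge0.
transitivity (\int[pushforward (mrestr P mA) Y]_x g x).
  by rewrite ge0_integral_pushforward.
rewrite (eq_measure_integral (mscale (NngNum PA0) (pushforward P Y))); last first.
  move=> B mB _; transitivity (P (A `&` Y @^-1` B)); first by rewrite setIC.
  rewrite AY //; transitivity ((fine (P A))%:E * P (Y @^-1` B)) => //.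
  by rewrite fineK // fin_num_measure.
rewrite ge0_integral_mscale //= fineK ?fin_num_measure //.
by rewrite ge0_integral_pushforward.
Qed.

Lemma ge0_integral_eq_law (X Y : {RV P >-> R}) (g : R -> \bar R) :
  measurable_fun setT g -> (forall x, 0 <= g x) ->
  (forall B, measurable B -> P (X @^-1` B) = P (Y @^-1` B)) ->
  \int[P]_w g (X w) = \int[P]_w g (Y w).
Proof.
move=> mg g0 XY.
transitivity (\int[pushforward P X]_x g x); first by rewrite ge0_integral_pushforward.
transitivity (\int[pushforward P Y]_x g x); last by rewrite ge0_integral_pushforward.
by apply: eq_measure_integral => B mB _; exact: XY.
Qed.

End independent_integral.

Section ae_sets.
Context d (T : measurableType d) (R : realType) (P : {measure set T -> \bar R}).

Lemma ae_le_measure (A B : set T) : measurable A -> measurable B ->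
  {ae P, forall w, A w -> B w} -> (P A <= P B)%E.
Proof.
move=> mA mB [N [mN PN0 ABN]].
have AB : A `<=` B `|` N.
  by move=> w Aw; apply: contrapT => /not_orP[nB]; apply; apply: ABN => /(_ Aw).
apply: (@le_trans _ _ (P (B `|` N))).
  by apply: le_measure AB; rewrite inE //; exact: measurableU.
have : (P (B `|` N) <= P B + P N)%E by exact: measureU2.
by rewrite PN0 adde0.
Qed.

Lemma ae_eq_measure (A B : set T) : measurable A -> measurable B ->
  {ae P, forall w, A w <-> B w} -> P A = P B.
Proof.
move=> mA mB AB; apply/eqP; rewrite eq_le; apply/andP; split;
  by apply: ae_le_measure => //; apply: filterS AB => w [].
Qed.

End ae_sets.

(** * Arrival times *)

Section arrivals.
Context d (T : measurableType d) (R : realType) (P : probability T R).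
Variable S : nat -> {RV P >-> R}.

Lemma measurable_arrival_le k t : measurable [set w | S k w <= t].
Proof. by rewrite -[X in measurable X]setTI; exact: measurable_fun_le. Qed.

Lemma arrival_countE t (w : T) : S 0 w = 0 ->
  (forall k, S k w < S k.+1 w) -> (exists k, t < S k w) -> 0 <= t ->
  forall k, (k <= arrival_count S t w)%N = (S k w <= t).
Proof.
move=> S0 Slt [m tm] t0.
have Sle : {homo (fun k => S k w) : i j / (i <= j)%N >-> i <= j}.
  by apply: homo_leq => //; [exact: le_trans|move=> i; exact: ltW].
have bound j : S j w <= t -> (j <= m)%N.
  by move=> Sj; rewrite leqNgt; apply/negP => /ltnW/Sle; lra.
have ex0 : exists k, S k w <= t by exists 0%N; rewrite S0.
have [n Sn n_max] := ex_maxnP ex0 bound.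
have [SN N_max] : [set k | S k w <= t /\ forall j, S j w <= t -> (j <= k)%N]
    (arrival_count S t w) by apply: xgetPex; exists n.
move=> k; apply/idP/idP => [/Sle kN|]; [exact: le_trans kN SN|exact: N_max].
Qed.

(** A positive count is never the default of [xget], so it is a genuine maximum; the value 0 mixes
    in the default and is treated as the complement of all positive counts. *)
Lemma measurable_arrival_count t n : measurable [set w | arrival_count S t w = n].
Proof.
have pos k : (0 < k)%N -> measurable [set w | arrival_count S t w = k].
  move=> k0.
  have -> : [set w | arrival_count S t w = k] = [set w | S k w <= t] `&`
      \bigcap_(j in [set j | (k < j)%N]) ~` [set w | S j w <= t].
    apply/seteqP; split => w /=.
      move=> wk; have : exists i, S i w <= t /\ forall j, S j w <= t -> (j <= i)%N.
        apply: contrapT => nex; move: k0; rewrite -wk /arrival_count xgetPN //.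
        by move=> x Hx; apply: nex; exists x.
      move=> /(@xgetPex _ 0%N) [Sk kmax]; rewrite -wk; split => // j kj /kmax.
      by rewrite leqNgt kj.
    move=> [Sk kmax]; apply: xget_unique => /=.
      split => // j Sj; rewrite leqNgt; apply/negP => /kmax; exact.
    move=> i [Si imax]; apply/eqP; rewrite eqn_leq imax // andbT leqNgt.
    by apply/negP => /kmax; exact.
  apply: measurableI; first exact: measurable_arrival_le.
  apply: bigcap_measurableType => j _; apply: measurableC.
  exact: measurable_arrival_le.
case: n => [|n]; last exact: pos.
have -> : [set w | arrival_count S t w = 0%N] =
    ~` \bigcup_n [set w | arrival_count S t w = n.+1].
  apply/seteqP; split => w /=; first by move=> w0 [n _] /=; rewrite w0.
  by move=> nw; case E : (arrival_count S t w) => [//|n]; exfalso; apply: nw; exists n.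
by apply: measurableC; apply: bigcup_measurable => k _; exact: pos.
Qed.

Hypothesis S_poisson : poisson_arrivals 1 S.

(** Induction on k: almost surely, S_k <= t means that either S_(k+1) <= t or exactly k arrivals
    occur by time t. *)
Lemma probability_arrival_le t k : 0 < t ->
  P [set w | S k w <= t] = (poisson_tail t k)%:E.
Proof.
move=> t0; have [S_ae _ S_pmf] := S_poisson.
have countE : {ae P, forall w, [/\ S 0%N w = 0, 0 < S 1%N w &
    forall s k, 0 <= s -> (k <= arrival_count S s w)%N = (S k w <= s)]}.
  apply: filterS S_ae => w [S0 Slt Sub]; split=> // [|s k' s0]; first by rewrite -S0.
  exact: arrival_countE.
elim: k => [|k IH].
  rewrite poisson_tail0 -(probability_setT P); apply: ae_eq_measure => //.
    exact: measurable_arrival_le.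
  by apply: filterS countE => w [S0 _ _]; split => //= _; rewrite S0 ltW.
(* The Poisson law is given for increments only, so the count is taken from time 0, where it
   vanishes almost surely because S_1 > 0. *)
pose D n := [set w | (arrival_count S t w - arrival_count S 0 w)%N = n].
have mD n : measurable (D n).
  have -> : D n = \bigcup_i \bigcup_j
     (if ((i - j)%N == n) then [set w | arrival_count S t w = i] `&`
        [set w | arrival_count S 0 w = j] else set0).
    apply/seteqP; split => w /=.
      by move=> Dw; exists (arrival_count S t w) => //;
        exists (arrival_count S 0 w) => //; rewrite Dw eqxx.
    by move=> [i _ [j _]]; case: ifPn => // /eqP <- [/= <- <-].
  apply: bigcup_measurable => i _; apply: bigcup_measurable => j _.
  case: ifP => _ //; apply: measurableI; exact: measurable_arrival_count.
have PD n : P (D n) = (poisson_pmf t n)%:E.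
  by have := S_pmf 0 t n (lexx 0) t0; rewrite subr0 mul1r.
have mS j := measurable_arrival_le j t.
have count0E : {ae P, forall w, D k w <-> S k w <= t < S k.+1 w}.
  apply: filterS countE => w [_ S1 cE].
  have c0 : arrival_count S 0 w = 0%N.
    by apply/eqP; rewrite -leqn0 leqNgt cE // -ltNge.
  rewrite /D /= c0 subn0 ltNge -!cE ?ltW //; lia.
(* Removing a null part makes the two events of the induction step disjoint everywhere, so that
   probabilities add. *)
have Dae : P (D k) = P (D k `\` [set w | S k.+1 w <= t]).
  apply: ae_eq_measure => //; first exact: measurableD.
  apply: filterS count0E => w Dw; split => [wk|[]//]; split => //=.
  by case/Dw/andP: wk => _; rewrite ltNge => /negP.
have : P [set w | S k w <= t] =
    P ([set w | S k.+1 w <= t] `|` (D k `\` [set w | S k.+1 w <= t])).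
  apply: ae_eq_measure => //; first by apply: measurableU => //; exact: measurableD.
  have SS : {ae P, forall w, S k w < S k.+1 w} by apply: filterS S_ae => w [].
  apply: filterS2 SS count0E => w Slt [Dw wD]; split => /=.
    move=> Sk; case: (leP (S k.+1 w) t) => Sk'; [by left|right].
    by split; [apply: wD; rewrite Sk|move=> Sk2; move: Sk'; rewrite ltNge => /negP].
  by move=> [Sk|[/Dw/andP[//]]]; exact: le_trans (ltW Slt) Sk.
set A := [set w | S k.+1 w <= t] in Dae *.
have -> : P (A `|` (D k `\` A)) = (P A + P (D k `\` A))%E.
  by apply: measureU; [exact: mS|exact: measurableD (mD k) (mS _)|exact: setDIK].
rewrite -Dae IH PD poisson_tailS => tailE.
by rewrite EFinB tailE addeK.
Qed.

End arrivals.

(** * Closure properties of generated sigma-algebras *)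

Section generated_sigma_algebra.
Context d (T : measurableType d) d' (U : measurableType d').
Variables (I : Type) (D : set I) (f : I -> T -> U).

Lemma generated_preimage i (B : set U) : D i -> measurable B ->
  generated_sigma_algebra D f (f i @^-1` B).
Proof.
move=> Di mB; apply: sub_sigma_algebra; exists i => //.
by exists B => //; rewrite setTI.
Qed.

Lemma generated_bigcap (J : set nat) (F : nat -> set T) :
  (forall j, J j -> generated_sigma_algebra D f (F j)) ->
  generated_sigma_algebra D f (\bigcap_(j in J) F j).
Proof.
move=> mF; rewrite -[X in generated_sigma_algebra _ _ X]setCK setC_bigcap.
rewrite bigcup_mkcond; apply: sigma_algebraC; apply: sigma_algebra_bigcup => j.
case: ifPn => [/set_mem /mF|_]; first exact: sigma_algebraC.
exact: sigma_algebra0.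
Qed.

Lemma generated_setI (A B : set T) :
  generated_sigma_algebra D f A -> generated_sigma_algebra D f B ->
  generated_sigma_algebra D f (A `&` B).
Proof.
move=> mA mB; rewrite -bigcap2E.
apply: generated_bigcap => -[|[|j]] //= _.
by rewrite -setC0; apply: sigma_algebraC; exact: sigma_algebra0.
Qed.

End generated_sigma_algebra.

(** * Marks at arrival times, threshold rules and the prophet bound *)

Definition arrived T (R : realType) (S : nat -> T -> R) (t : R) (k : nat) : set T :=
  [set w | S k w <= t].

(* C i constrains the mark of index i + 1. *)
Definition marks T (R : realType) (Xs : nat -> T -> R) (k : nat)
    (C : nat -> set R) : set T :=
  [set w | forall i, (i < k)%N -> C i (Xs i.+1 w)].

(* The cap n + 1 keeps the rule total: on the event that no mark exceeds c,
   no finite number of observations could otherwise decide its value. *)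
Definition first_exceedance T (R : realType) (Xs : nat -> T -> R) (c : R) (n : nat)
    (w : T) : nat :=
  (find (fun i => c < Xs i.+1 w) (iota 0 n)).+1.

(** Each level set depends on the first m + 1 marks only. The case m = n is the cap: none of the
    first n marks exceeds c, and mark n + 1 is unconstrained. *)
Lemma first_exceedanceE T (R : realType) (Xs : nat -> T -> R) c n m :
  [set w | first_exceedance Xs c n w = m.+1] =
  if (m <= n)%N then
    marks Xs m (fun=> `]-oo, c]%classic) `&`
    (if (m < n)%N then Xs m.+1 @^-1` `]c, +oo[ else setT)
  else set0.
Proof.
rewrite /first_exceedance /marks; apply/seteqP; split => w /=.
  move=> [<-]; rewrite -[X in (_ <= X)%N](size_iota 0 n) find_size.
  split=> [i|].
    move=> /[dup] im /(before_find 0%N); rewrite nth_iota ?add0n; last first.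
      by rewrite (leq_trans im) // -[leqRHS](size_iota 0 n) find_size.
    by rewrite in_itv /= leNgt => ->.
  case: ifPn => // mn; rewrite /= in_itv /= andbT.
  have : has (fun i => c < Xs i.+1 w) (iota 0 n) by rewrite has_find size_iota.
  by move=> /(nth_find 0%N); rewrite nth_iota // add0n.
case: ifPn => // mn [H Hm]; congr S.
case: findP => [|i]; rewrite size_iota.
  move=> /hasPn nh; case: ltnP Hm => [mn'|nm _]; last first.
    by apply/eqP; rewrite eqn_leq mn nm.
  rewrite /= in_itv/= andbT => cX; have : m \in iota 0 n by rewrite mem_iota.
  by move=> /nh; rewrite cX.
move=> im /(_ 0%N); rewrite nth_iota // add0n => cX bef.
case: (ltngtP i m) => // [ltim|ltmi].
  by have := H _ ltim; rewrite in_itv /= leNgt cX.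
move: Hm; rewrite (ltn_trans ltmi im) /= in_itv /= andbT => cXm.
by have := bef 0%N _ ltmi; rewrite nth_iota ?(ltn_trans ltmi im) // add0n cXm.
Qed.

(** * Joint laws of arrivals and independent marks *)

Section independent_marks.
Context d (T : measurableType d) (R : realType) (P : probability T R).
Variables (X : {RV P >-> R}) (Xs S : nat -> {RV P >-> R}) (t : R).
Hypothesis t_gt0 : 0 < t.
Hypothesis Xs_law : forall k (B : set R), (0 < k)%N -> measurable B ->
  distribution P (Xs k) B = distribution P X B.
Hypothesis Xs_indep : mutually_independent P positive_indices Xs.
Hypothesis S_poisson : poisson_arrivals 1 S.
Hypothesis S_Xs_indep : independent_classes P
  (generated_sigma_algebra positive_indices S)
  (generated_sigma_algebra positive_indices Xs).

Local Notation arrived := (arrived S t).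
Local Notation marks := (marks Xs).

Let marksE k C : marks k C = \bigcap_(i in [set i | (i < k)%N]) Xs i.+1 @^-1` C i.
Proof. by apply/seteqP; split. Qed.

Lemma measurable_marks k C : (forall i, measurable (C i)) -> measurable (marks k C).
Proof.
move=> mC; rewrite marksE; apply: bigcap_measurableType => i _.
exact: measurable_funPTI.
Qed.

Lemma probability_marks k C : (forall i, measurable (C i)) ->
  P (marks k C) = (\prod_(i < k) P (X @^-1` C i))%E.
Proof.
move=> mC.
(* Marks are numbered from 1 and constraints from 0, hence the index set {1, ..., k} with
   [C i.-1]. *)
pose J := seq_fset tt (iota 1 k).
have JE i : (i \in J) = (0 < i <= k)%N by rewrite seq_fsetE mem_iota; lia.
have -> : marks k C = \bigcap_(i in [set` J]) Xs i @^-1` C i.-1.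
  apply/seteqP; split => w /= H i.
    by rewrite /= JE; case: i => // i ik; exact: H.
  by move=> ik; apply: (H i.+1); rewrite /= JE.
rewrite Xs_indep //; last first.
  by move=> i /=; rewrite JE /positive_indices /=; lia.
rewrite (perm_big _ (seq_fset_perm _ _)) undup_id ?iota_uniq //=.
rewrite -[in LHS](addn0 1%N) iotaDl big_map -[k in iota 0 k]subn0 -/(index_iota 0 k).
rewrite big_mkord; apply: eq_bigr => i _.
exact: (Xs_law (k := i.+1)).
Qed.

Lemma probability_arrival_marks k C : (forall i, measurable (C i)) ->
  P (arrived k.+1 `&` marks k.+1 C) =
  ((poisson_tail t k.+1)%:E * \prod_(i < k.+1) P (X @^-1` C i))%E.
Proof.
move=> mC; rewrite S_Xs_indep ?probability_arrival_le ?probability_marks //.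
  have -> : arrived k.+1 = S k.+1 @^-1` `]-oo, t].
    by apply/seteqP; split => w /=; rewrite in_itv.
  exact: generated_preimage.
rewrite marksE; apply: generated_bigcap => i _.
exact: generated_preimage.
Qed.

(** The mark k + 1 is independent of the earlier marks and of all arrival times, so the integral
    factors. *)
Lemma integral_arrival_marks k C (g : R -> \bar R) : (forall i, measurable (C i)) ->
  measurable_fun setT g -> (forall x, 0 <= g x)%E ->
  (\int[P]_(w in arrived k.+1 `&` marks k C) g (Xs k.+1 w) =
   (poisson_tail t k.+1)%:E * \prod_(i < k) P (X @^-1` C i) * \int[P]_w g (X w))%E.
Proof.
move=> mC mg g0.
(* Adding the constraint [B] on mark k + 1 turns the joint event into another [marks] event of known
   probability. *)
pose C' B i := if (i == k)%N then B else C i.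
have mC' B : measurable B -> forall i, measurable (C' B i).
  by move=> mB i; rewrite /C'; case: ifP.
have split_last (B : set R) : arrived k.+1 `&` marks k C `&` Xs k.+1 @^-1` B =
    arrived k.+1 `&` marks k.+1 (C' B).
  rewrite -setIA; congr (_ `&` _); apply/seteqP; split => w /=.
    move=> [H Bw] i; rewrite ltnS leq_eqVlt /C' => /orP[/eqP ->|ik].
      by rewrite eqxx.
    by rewrite ltn_eqF //; exact: H.
  move=> H; split; last by have := H k (ltnSn k); rewrite /C' eqxx.
  by move=> i ik; have := H i (ltnW ik); rewrite /C' ltn_eqF.
have prodC' B : (\prod_(i < k.+1) P (X @^-1` C' B i) =
    \prod_(i < k) P (X @^-1` C i) * P (X @^-1` B))%E.
  rewrite big_ord_recr /= /C' eqxx; congr (_ * _)%E.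
  by apply: eq_bigr => i _; rewrite ltn_eqF.
have PA : P (arrived k.+1 `&` marks k C) =
    ((poisson_tail t k.+1)%:E * \prod_(i < k) P (X @^-1` C i))%E.
  have := split_last setT; rewrite preimage_setT setIT => ->.
  rewrite probability_arrival_marks; last exact: mC'.
  by rewrite prodC' preimage_setT probability_setT mule1.
rewrite (ge0_integral_indep (A := _ `&` _)) //.
- rewrite PA; congr (_ * _)%E; apply: ge0_integral_eq_law => // B mB.
  exact: Xs_law.
- apply: measurableI; [exact: measurable_arrival_le|exact: measurable_marks].
- move=> B mB; rewrite split_last probability_arrival_marks; last exact: mC'.
  rewrite prodC' PA muleA; congr (_ * _)%E; apply/esym.
  exact: Xs_law.
Qed.

Lemma stopping_rule_first_exceedance c n : stopping_rule Xs S (first_exceedance Xs c n).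
Proof.
split=> [//|[//|m] _]; rewrite first_exceedanceE.
(* An event about X_j alone is read as an event about the observed pair (X_j, S_j). *)
have mX j (B : set R) : (0 < j <= m.+1)%N -> measurable B ->
    generated_sigma_algebra [set j | (1 <= j <= m.+1)%N]
      (fun j w => (Xs j w, S j w)) (Xs j @^-1` B).
  move=> jm mB; have -> : Xs j @^-1` B =
    (fun w => (Xs j w, S j w)) @^-1` (fst @^-1` B) by [].
  apply: generated_preimage => //.
  by rewrite -[X in measurable X]setTI; exact: measurable_fst.
case: ifPn => [_|_]; last exact: sigma_algebra0.
apply: generated_setI.
  have -> : marks m (fun=> `]-oo, c]%classic) =
      \bigcap_(i in [set i | (i < m)%N]) Xs i.+1 @^-1` `]-oo, c].
    by apply/seteqP; split.
  by apply: generated_bigcap => i /= im; apply: mX => //; lia.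
case: ifPn => _; first by apply: mX => //; lia.
by rewrite -setC0; apply: sigma_algebraC; exact: sigma_algebra0.
Qed.

(** * Lower bound on the optimal value from capped threshold rules *)

Hypothesis Xs_ge0 : forall k w, (0 < k)%N -> 0 <= Xs k w.

(** The reward is split by the index k + 1 of the first exceedance: that mark arrives by t and the k
    earlier ones stay below c. Rewards collected at the cap are dropped. *)
Lemma optimal_stopping_value_ge c n : 0 <= c ->
  ((\sum_(k < n) poisson_tail t k.+1 * fine (P (X @^-1` `]-oo, c])) ^+ k)%:E *
    \int[P]_w (if c < X w then X w else 0)%:E <= optimal_stopping_value Xs S t)%E.
Proof.
move=> c0; pose g (x : R) : \bar R := (if c < x then x else 0)%:E.
have g0 x : (0 <= g x)%E.
  by rewrite lee_fin; case: ifPn => // cx; exact: le_trans c0 (ltW cx).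
have mg : measurable_fun setT g.
  apply/measurable_EFinP; apply: measurable_fun_ifT => //.
  exact: measurable_fun_ltr.
pose A k := arrived k.+1 `&` marks k (fun=> `]-oo, c]%classic).
have mA k : measurable (A k).
  by apply: measurableI; [exact: measurable_arrival_le|exact: measurable_marks].
have mgX k : measurable_fun setT ((fun w => g (Xs k w)) \_ (A k.-1)).
  apply/(measurable_restrictT _ _).1 => //.
  by apply: measurable_funTS; exact: measurableT_comp.
have fP : P (X @^-1` `]-oo, c]) \is a fin_num.
  by apply: fin_num_measure; exact: measurable_funPTI.
have term (k : 'I_n) : true -> (\int[P]_w ((fun w => g (Xs k.+1 w)) \_ (A k)) w =
   (poisson_tail t k.+1 * fine (P (X @^-1` `]-oo, c])) ^+ k)%:E * \int[P]_w g (X w))%E.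
  move=> _; rewrite -integral_mkcond.
  rewrite (integral_arrival_marks k (C := fun=> `]-oo, c]%classic)) //.
  congr (_ * _)%E; rewrite EFinM; congr (_ * _)%E.
  by rewrite -[in LHS](fineK fP) prodEFin prodr_const card_ord.
apply: (@le_trans _ _
   (\int[P]_w (\sum_(k < n) ((fun w => g (Xs k.+1 w)) \_ (A k)) w))%E).
  rewrite ge0_integral_sum //; last 2 first.
  - by move=> k; exact: (mgX k.+1).
  - by move=> k w _; rewrite patchE; case: ifP.
  rewrite (eq_bigr _ term) -ge0_sume_distrl; last first.
    by move=> k _; rewrite lee_fin mulr_ge0 ?poisson_tail_ge0 ?exprn_ge0 ?fine_ge0.
  by rewrite sumEFin.
apply: le_ereal_sup_tmp; eexists.
  by exists (first_exceedance Xs c n); first exact: stopping_rule_first_exceedance.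
rewrite expectation.unlock; apply: ge0_le_integral_nonmeasurable => w.
  by apply: sume_ge0 => k _; rewrite patchE; case: ifP.
set m := first_exceedance Xs c n w.
have : [set w | first_exceedance Xs c n w = m.-1.+1] w by [].
rewrite first_exceedanceE; case: ifPn => // mn [/= Hm Hm'].
have m_def : m = m.-1.+1 by [].
(* Only the stopping index contributes: before it the mark is at most c, and after it [A k] fails
   because an earlier mark exceeds c. *)
have Em k : (k < n)%N -> k != m.-1 -> ((fun w => g (Xs k.+1 w)) \_ (A k)) w = 0%E.
  move=> kn km; rewrite patchE; case: ifPn => // /set_mem [_ Hk].
  case: (ltngtP k m.-1) km => // [km|mk] _.
    by have := Hm _ km; rewrite /= in_itv /= leNgt /g => /negbTE ->.
  have := Hk _ mk; rewrite /= in_itv /= leNgt => /negP; case.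
  by move: Hm'; rewrite (ltn_trans mk kn) /= in_itv /= andbT.
have RHS0 : 0 <= Xs m w * \1_[set w' | S (first_exceedance Xs c n w') w' <= t] w.
  by rewrite mulr_ge0 // Xs_ge0.
(* If the cap was reached, every term vanishes and the nonnegative reward suffices. *)
case: (ltnP m.-1 n) Hm' => [mn'|nm] Hm'; last first.
  rewrite big1 ?lee_fin // => k _; apply: Em => //.
  by rewrite neq_ltn (leq_trans (ltn_ord k) nm).
rewrite (bigD1 (Ordinal mn')) //= big1 ?adde0; last first.
  by move=> k km; apply: Em.
rewrite patchE; case: ifPn => [/set_mem [Sm _]|_]; last by rewrite lee_fin.
move: Hm'; rewrite /= in_itv /= andbT => cX.
rewrite lee_fin /g cX indicE mem_set ?mulr1 //.
Qed.

(** * Upper bound on the prophet value *)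

Local Notation pos_part c x := ((Num.max (x - c) 0)%:E).

(** The amount by which the union bound overcounts the first two marks; it is the source of the
    strict inequality. *)
Local Notation overlap c w :=
  ((Num.min (Num.max (Xs 1%N w - c) 0) (Num.max (Xs 2%N w - c) 0))%:E).

Let measurable_pos_part c : measurable_fun setT (fun x : R => pos_part c x).
Proof.
apply/measurable_EFinP; apply: measurable_maxr => //.
exact: measurable_funB.
Qed.

Let measurable_overlap c : measurable_fun setT (fun w => overlap c w).
Proof.
apply/measurable_EFinP; apply: measurable_minr; apply: measurable_maxr => //;
  exact: measurable_funB.
Qed.

Let pos_part_ge0 (c x : R) : (0 <= pos_part c x)%E.
Proof. by rewrite lee_fin le_max lexx orbT. Qed.

Let overlap_ge0 c w : (0 <= overlap c w)%E.
Proof. by rewrite lee_fin le_min !le_max !lexx !orbT. Qed.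

Lemma integral_arrived_pos_part c k :
  (\int[P]_(w in arrived k.+1) pos_part c (Xs k.+1 w) =
   (poisson_tail t k.+1)%:E * \int[P]_w pos_part c (X w))%E.
Proof.
have := integral_arrival_marks k (C := fun=> setT) (g := fun x => pos_part c x).
have -> : marks k (fun=> setT) = setT by apply/seteqP; split.
rewrite setIT => -> //.
by rewrite big1 ?mule1 // => i _; rewrite preimage_setT probability_setT.
Qed.

(** Every mark has the same mean excess, and the weights, the Poisson tails, sum to at most t. *)
Lemma sum_integral_pos_part_le c :
  (\sum_(k <oo) \int[P]_(w in arrived k.+1) pos_part c (Xs k.+1 w) <=
   t%:E * \int[P]_w pos_part c (X w))%E.
Proof.
apply: lime_le.
  by apply: is_cvg_nneseries => k _ _; apply: integral_ge0.
near=> n; rewrite (eq_bigr _ (fun k _ => integral_arrived_pos_part c k)).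
rewrite -ge0_sume_distrl; last by move=> k _; rewrite lee_fin poisson_tail_ge0.
rewrite big_mkord sumEFin lee_wpmul2r ?integral_ge0 //.
by rewrite lee_fin sum_poisson_tail_le.
Unshelve. all: by end_near. Qed.

(** A zero integral would make null the event that mark 2 arrives by t and both marks exceed c,
    whose probability is a positive tail times a positive square. *)
Lemma integral_overlap_gt0 c : (0 < P (X @^-1` `]c, +oo[))%E ->
  (0 < \int[P]_(w in arrived 2) overlap c w)%E.
Proof.
move=> p0.
have mA : measurable (arrived 2) by exact: measurable_arrival_le.
rewrite lt0e integral_ge0 ?andbT //; apply/eqP => int0.
have /(ae_eq_integral_abs P mA (measurable_funTS (measurable_overlap c))) :
    (\int[P]_(w in arrived 2) `|overlap c w| = 0)%E.
  by rewrite -[RHS]int0; apply: eq_integral => w _; rewrite gee0_abs.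
pose B := arrived 2 `&` marks 2 (fun=> `]c, +oo[%classic).
have mB : measurable B by apply: measurableI => //; exact: measurable_marks.
move=> ae0; have : (P B <= P set0)%E.
  apply: ae_le_measure => //; apply: filterS ae0 => w H [/H Ww Hm].
  have X1 : c < Xs 1 w by have := Hm 0%N isT; rewrite /= in_itv /= andbT.
  have X2 : c < Xs 2 w by have := Hm 1%N isT; rewrite /= in_itv /= andbT.
  case: Ww => /eqP; rewrite gt_eqF //.
  by rewrite lt_min !lt_max !subr_gt0 X1 X2.
rewrite measure0 probability_arrival_marks // !big_ord_recr big_ord0 /= mul1e.
by rewrite leNgt !mule_gt0 // lte_fin poisson_tail_gt0.
Qed.

(** [I] is the integral of the union bound reduced by the overlap. The saving is stated as a sum,
    which avoids subtracting extended reals. *)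
Lemma prophet_value_le c : 0 <= c ->
  exists2 I : \bar R, (prophet_value Xs S t <= I)%E &
    (I + \int[P]_(w in arrived 2) overlap c w <=
     (c * (1 - expR (- t)))%:E + t%:E * \int[P]_w pos_part c (X w))%E.
Proof.
move=> c0.
(* max(x1, x2) <= c + (x1 - c)^+ + ((x2 - c)^+ - min((x1 - c)^+, (x2 - c)^+)),
   so the overlap can be subtracted from the second term of the union bound. *)
pose excess k w := if k == 1%N then (pos_part c (Xs 2 w) - overlap c w)%E
                   else pos_part c (Xs k.+1 w).
pose loss k w := if k == 1%N then overlap c w else 0%E.
have splitE k w : (excess k w + loss k w = pos_part c (Xs k.+1 w))%E.
  rewrite /excess /loss; case: eqVneq => [->|_]; last by rewrite adde0.
  by rewrite subeK.
have ge0 k w : (0 <= excess k w)%E.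
  rewrite /excess; case: eqVneq => // _.
  by rewrite -EFinB lee_fin subr_ge0 ge_min lexx orbT.
have loss_ge0 k w : (0 <= loss k w)%E by rewrite /loss; case: ifP.
have mX k : measurable_fun setT (fun w => pos_part c (Xs k w)).
  exact: (measurableT_comp (measurable_pos_part c)).
have mexcess k : measurable_fun setT (excess k).
  rewrite /excess; case: (k == 1%N) => //; exact: emeasurable_funB.
have mloss k : measurable_fun setT (loss k).
  by rewrite /loss; case: (k == 1%N).
have mA k : measurable (arrived k) by exact: measurable_arrival_le.
pose h k := (excess k) \_ (arrived k.+1).
have mh k : measurable_fun setT (h k).
  by apply/(measurable_restrictT _ _).1 => //; exact: measurable_funTS.
have h0 k w : (0 <= h k w)%E by rewrite /h patchE; case: ifP.
(* The pointwise bound: c as soon as one mark arrives, plus the reduced excesses of all marks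
   arriving by t. *)
pose G w := ((cst c%:E) \_ (arrived 1) w + \sum_(k <oo) h k w)%E.
have sum0 w : (0 <= \sum_(k <oo) h k w)%E by exact: nneseries_ge0.
have mc : measurable_fun setT ((cst c%:E) \_ (arrived 1)).
  by apply/(measurable_restrictT _ _).1 => //; exact: measurable_cst.
have mc0 w : (0 <= ((cst c%:E) \_ (arrived 1)) w)%E.
  by rewrite patchE; case: ifP; rewrite //= lee_fin.
have msum : measurable_fun setT (fun w => \sum_(k <oo) h k w)%E.
  exact: ge0_emeasurable_sum.
exists (\int[P]_w G w)%E.
  rewrite /prophet_value expectation.unlock; apply: ge0_ae_le_integral.
  - move=> w; rewrite lee_fin big_seq; elim/big_ind : _ => // [x y x0 y0|k].
      by rewrite le_max x0.
    by rewrite mem_index_iota => /andP[k0 _]; exact: Xs_ge0.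
  - by move=> w; rewrite adde_ge0.
  - exact: emeasurable_funD.
  have [S_ae _ _] := S_poisson.
  apply: filterS S_ae => w [S0 Slt Sub].
  have NE := arrival_countE S0 Slt (Sub t) (ltW t_gt0).
  have G0 : (0 <= G w)%E by rewrite adde_ge0.
  rewrite big_seq; elim/big_ind : _ => // [x y xG yG|k].
    by rewrite maxEle; case: ifP.
  rewrite mem_index_iota => /andP[k0 kN].
  have Sk : S k w <= t by rewrite -NE.
  have Ak j : (0 < j <= k)%N -> w \in arrived j.
    by move=> /andP[_ jk]; rewrite inE /arrived /= -NE (leq_trans jk).
  rewrite /G patchE (Ak 1%N) ?k0 //=.
  (* To dominate the mark k, the terms of the marks 1 to k suffice; all of these have arrived. *)
  apply: (@le_trans _ _ (c%:E + \sum_(0 <= j < k) h j w)%E); last first.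
    by rewrite leeD2l // nneseries_lim_ge.
  have hE j : (j < k)%N -> h j w = excess j w.
    by move=> jk; rewrite /h patchE (Ak j.+1).
  have partial0 n : (0 <= \sum_(0 <= j < n) h j w)%E by apply: sume_ge0.
  have Xc j : ((Xs j w)%:E <= c%:E + pos_part c (Xs j w))%E.
    by rewrite -EFinD lee_fin; have [] := leP (Xs j w - c) 0; lra.
  (* Marks 1, 2 and later. For mark 2 the excess of mark 1 pays for the subtracted overlap;
     otherwise the mark's own excess is enough. *)
  case: k k0 {kN Sk Ak} hE => // -[|[|k]] _ hE.
  - rewrite big_nat1 hE // /excess /=; exact: Xc.
  - rewrite big_nat_recr // big_nat1 /= !hE // /excess /= .
    rewrite -!EFinD lee_fin.
    have : Xs 2 w - c <= Num.max (Xs 2 w - c) 0 by rewrite le_max lexx.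
    have : Num.min (Num.max (Xs 1 w - c) 0) (Num.max (Xs 2 w - c) 0) <=
      Num.max (Xs 1 w - c) 0 by rewrite ge_min lexx.
    lra.
  - rewrite big_nat_recr //= (hE k.+2) // /excess /=.
    by apply: le_trans (Xc _) _; rewrite leeD2l // leeDr.
have -> : (\int[P]_w G w =
    (c * (1 - expR (- t)))%:E + \int[P]_w (\sum_(k <oo) h k w))%E.
  rewrite ge0_integralD // -integral_mkcond integral_cst // EFinM -poisson_tail1 //.
  by congr (_ * _ + _)%E; exact: probability_arrival_le.
rewrite -addeA leeD2l //.
apply: le_trans (sum_integral_pos_part_le c).
rewrite integral_nneseries //.
have int_split k : (\int[P]_(w in arrived k.+1) pos_part c (Xs k.+1 w) =
    \int[P]_w h k w + \int[P]_(w in arrived k.+1) loss k w)%E.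
  rewrite -integral_mkcond -ge0_integralD //; last 2 first.
  - exact: measurable_funTS.
  - exact: measurable_funTS.
  by apply: eq_integral => w _; rewrite splitE.
rewrite (eq_eseriesr (fun k _ => int_split k)) [leRHS]nneseriesD; last 2 first.
- by move=> *; apply: integral_ge0.
- by move=> *; apply: integral_ge0.
rewrite leeD2l //.
(* The overlap is the loss of index 1, so the first two terms of the series already contain it. *)
apply: le_trans (nneseries_lim_ge 2 _); last by move=> *; apply: integral_ge0.
by rewrite big_nat_recr //= leeDr // sume_ge0 // => *; apply: integral_ge0.
Qed.

(** * The value of a threshold rule in closed form *)

Hypothesis X_ge0 : forall w, 0 <= X w.
Hypothesis X_finite : ('E_P[X] < +oo)%E.

Lemma integral_pos_part_fin_num c : 0 <= c ->
  (\int[P]_w pos_part c (X w))%E \is a fin_num.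
Proof.
move=> c0; rewrite ge0_fin_numE ?integral_ge0 //.
apply: le_lt_trans X_finite; rewrite expectation.unlock.
apply: ge0_le_integral_nonmeasurable => // w.
by rewrite lee_fin ge_max X_ge0 andbT; lra.
Qed.

Lemma integral_above_threshold c : 0 <= c ->
  (\int[P]_w (if (c < X w)%R then X w else 0)%:E =
   \int[P]_w pos_part c (X w) + c%:E * P (X @^-1` `]c, +oo[))%E.
Proof.
move=> c0.
have mB : measurable (X @^-1` `]c, +oo[) by exact: measurable_funPTI.
have -> : (c%:E * P (X @^-1` `]c, +oo[) =
    \int[P]_w ((cst c%:E) \_ (X @^-1` `]c, +oo[)) w)%E.
  by rewrite -integral_mkcond integral_cst.
rewrite -ge0_integralD //.
- apply: eq_integral => w _; rewrite patchE.
  have -> : (w \in X @^-1` `]c, +oo[) = (c < X w).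
    by apply/idP/idP; rewrite inE /= in_itv /= andbT.
  by case: ltP => cX; rewrite ?adde0 -?EFinD; congr EFin;
    [rewrite max_l|rewrite max_r]; lra.
- exact: (measurableT_comp (measurable_pos_part c)).
- by move=> w _; rewrite patchE; case: ifP => //=; rewrite lee_fin.
- by apply/(measurable_restrictT _ _).1 => //; exact: measurable_cst.
Qed.

(** The bounds for the capped rules hold for every cap n and pass to the limit. *)
Lemma threshold_value_le v c : 0 <= c -> (optimal_stopping_value Xs S t <= v%:E)%E ->
  let e := fine (\int[P]_w pos_part c (X w))%E in
  let p := fine (P (X @^-1` `]c, +oo[)) in
  0 < p -> (1 - expR (- (p * t))) / p * (e + c * p) <= v.
Proof.
move=> c0 Vv e p p0.
have eE := fineK (integral_pos_part_fin_num c0).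
have mB : measurable (X @^-1` `]c, +oo[) by exact: measurable_funPTI.
have pE : p%:E = P (X @^-1` `]c, +oo[) by rewrite fineK // fin_num_measure.
have p1 : p <= 1 by rewrite -lee_fin pE probability_le1.
have zE : fine (P (X @^-1` `]-oo, c])) = 1 - p.
  have -> : X @^-1` `]-oo, c] = ~` (X @^-1` `]c, +oo[).
    by apply/seteqP; split => w /=; rewrite !in_itv /= andbT leNgt => /negP.
  by rewrite probability_setC // -pE.
have bound n : (\sum_(k < n) (1 - p) ^+ k * poisson_tail t k.+1) * (e + c * p) <= v.
  rewrite -lee_fin; apply: le_trans Vv; apply: le_trans (optimal_stopping_value_ge n c0).
  have -> : (\int[P]_w (if (c < X w)%R then X w else 0)%:E = (e + c * p)%:E)%E.
    by rewrite integral_above_threshold // -eE -pE.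
  rewrite zE -EFinM lee_fin.
  by under eq_bigr do rewrite mulrC.
have z01 : 0 <= 1 - p < 1 by lra.
have := cvg_sum_poisson_tail t_gt0 z01; rewrite subKr => cv.
by apply: (cvgr_to_le (cvgMr_tmp cv)); exact: nearW.
Qed.

End independent_marks.

(** * Comparison of the two bounds at one threshold *)

Theorem corollary4p3 (d : measure_display) (T : measurableType d)
    (R : realType) (P : probability T R)
    (X : {RV P >-> R}) (Xs S : nat -> {RV P >-> R})
    (X_ge0 : forall w, 0 <= X w)
    (Xs_ge0 : forall k w, (0 < k)%N -> 0 <= Xs k w)
    (Xs_law : forall k (B : set R), (0 < k)%N -> measurable B ->
       distribution P (Xs k) B = distribution P X B)
    (Xs_indep : mutually_independent P positive_indices Xs)
    (X_finite : ('E_P[X] < +oo)%E)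
    (X_nonzero : (P [set w | X w = 0%R] < 1)%E)
    (S_poisson : poisson_arrivals 1 S)
    (S_Xs_indep : independent_classes P
       (generated_sigma_algebra positive_indices S)
       (generated_sigma_algebra positive_indices Xs))
    (t : R) (t_gt0 : 0 < t) :
  (prophet_value Xs S t / optimal_stopping_value Xs S t
     < (2 - (1 - expR (- t)) / t)%:E)%E.
Proof.
have stop_ge n c c0 := optimal_stopping_value_ge
  t_gt0 Xs_law Xs_indep S_poisson S_Xs_indep Xs_ge0 n (c := c) c0.
have stop_ge_threshold v c c0 := threshold_value_le
  t_gt0 Xs_law Xs_indep S_poisson S_Xs_indep Xs_ge0 X_ge0 X_finite (v := v) (c := c) c0.
have prophet_le c c0 := prophet_value_le
  t_gt0 Xs_law Xs_indep S_poisson S_Xs_indep Xs_ge0 (c := c) c0.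
have overlap_gt0 c := integral_overlap_gt0
  t_gt0 Xs_law Xs_indep S_poisson S_Xs_indep (c := c).
have e_fin c c0 := integral_pos_part_fin_num X_ge0 X_finite (c := c) c0.
pose q := (1 - expR (- t)) / t.
have a0 : 0 < 1 - expR (- t) by rewrite subr_gt0 expR_lt1 oppr_lt0.
have at1 : 1 - expR (- t) < t.
  by have := @expR_gt1Dx R (- t); rewrite oppr_eq0 gt_eqF // => /(_ isT); lra.
have q1 : q < 1 by rewrite ltr_pdivrMr // mul1r.
have EX0 : (0 < \int[P]_w (if (0 < X w)%R then X w else 0)%:E)%E.
  rewrite lt0e integral_ge0 ?andbT //; last first.
    by move=> w _; rewrite lee_fin; case: ifP.
  apply: contraPN X_nonzero => /eqP int0; apply/negP.
  rewrite -leNgt -(probability_setT P).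
  have mf : measurable_fun setT (fun w => (if 0 < X w then X w else 0)%:E).
    by apply/measurable_EFinP; apply: measurable_fun_ifT => //; exact: measurable_fun_ltr.
  have /(ae_eq_integral_abs P measurableT mf) ae0 :
      (\int[P]_w `|(if (0 < X w)%R then X w else 0)%:E| = 0)%E.
    rewrite -[RHS]int0; apply: eq_integral => w _.
    by rewrite gee0_abs // lee_fin; case: ifP.
  apply: ae_le_measure => //.
    exact: (measurable_funPTI X (measurable_set1 0)).
  apply: filterS ae0 => w H _; have := X_ge0 w; rewrite le_eqVlt => /orP[/eqP //|Xw].
  by have := H I; rewrite Xw => -[].
have V0 : (0 < optimal_stopping_value Xs S t)%E.
  (* Threshold 0 and cap 1: the first mark alone already gives a positive value. *)
  apply: lt_le_trans (stop_ge 1%N 0 (lexx 0)).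
  by rewrite big_ord1 expr0 mulr1 mule_gt0 // lte_fin poisson_tail_gt0.
(* An infinite optimal value makes the quotient 0, which is below 2 - q since q < 1. *)
case: (optimal_stopping_value Xs S t) V0 stop_ge_threshold => [v||] //; last first.
  by move=> _ _; rewrite invey mule0 lte_fin -/q; lra.
rewrite lte_fin => v0 /(_ v) stop_ge_v.
rewrite inver gt_eqF // lte_pdivrMr //.
pose k := (1 - expR (- t))^-1 - t^-1.
have k0 : 0 < k by rewrite subr_gt0 ltf_pV2.
pose c := k * v.
have c0 : 0 <= c by rewrite mulr_ge0 ?ltW.
have ca : c * (1 - expR (- t)) = (1 - q) * v.
  by rewrite /c /k /q; field; rewrite !gt_eqF.
have [I MI] := prophet_le c c0.
have eE := fineK (e_fin c c0); rewrite -eE -EFinM -EFinD.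
set b := (\int[P]_(w in arrived S t 2) _)%E => Ib.
have b0 : (0 <= b)%E.
  by apply: integral_ge0 => w _; rewrite lee_fin le_min !le_max !lexx !orbT.
have mB : measurable (X @^-1` `]c, +oo[) by exact: measurable_funPTI.
(* If no mark exceeds c, the mean excess vanishes and the bound (1 - q) v is already strict because
   v > 0. *)
have [p0|p0] := eqVneq (P (X @^-1` `]c, +oo[)) 0%E.
  have e0 : fine (\int[P]_w (Num.max (X w - c) 0)%:E)%E = 0.
    rewrite (ge0_negligible_integral mB) //.
    - rewrite integral0_eq // => w [_ /=]; rewrite in_itv /= andbT => /negP.
      by rewrite -leNgt -subr_le0 => /max_r ->.
    - apply/measurable_EFinP; apply: measurable_maxr => //; exact: measurable_funB.
    - by move=> w _; rewrite lee_fin le_max lexx orbT.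
  apply: (le_lt_trans MI); apply: (@le_lt_trans _ _ (I + b)%E); first by rewrite leeDl.
  apply: (le_lt_trans Ib); rewrite e0 mulr0 addr0 ca lte_fin -/q; lra.
have pgt0 : (0 < P (X @^-1` `]c, +oo[))%E by rewrite lt0e p0 measure_ge0.
have bgt0 := overlap_gt0 c pgt0.
have pE : (fine (P (X @^-1` `]c, +oo[)))%:E = P (X @^-1` `]c, +oo[).
  by rewrite fineK // fin_num_measure.
move: pgt0; rewrite -pE lte_fin => pgt0.
have := stop_ge_v c c0 (lexx _) pgt0.
set e := fine _ in Ib *; set p := fine _ in pE pgt0 * => Ve.
have p1 : 0 < p <= 1 by rewrite pgt0 -lee_fin pE probability_le1.
(* The chord inequality is multiplied by v; since c = k v, its term v p k is exactly c p and
   cancels. *)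
have te : t * e <= v.
  have hp := div_onem_expRN_le p1 t_gt0.
  have apt : 0 < 1 - expR (- (p * t)) by rewrite subr_gt0 expR_lt1 oppr_lt0 mulr_gt0.
  have : e + c * p <= v * (p / (1 - expR (- (p * t)))).
    by rewrite mulrA ler_pdivlMr // -ler_pdivrMr // [_ * (1 - _)]mulrC mulrAC.
  move: hp; rewrite -/k -(ler_pM2l v0) => hp /le_trans/(_ hp).
  rewrite mulrDr /c => H; have : e <= v / t by lra.
  by rewrite ler_pdivlMr // mulrC.
have {}Ib : (I + b <= ((2 - q) * v)%:E)%E.
  by apply: (le_trans Ib); rewrite lee_fin ca; lra.
(* A finite [I] is strictly below [I + b]; the value +oo is excluded by the finite bound on that
   sum. *)
apply: (le_lt_trans MI); case: I {MI} Ib => [r||_]; last exact: ltNyr.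
  by apply: lt_le_trans; rewrite lteDl.
by rewrite addye ?leye_eq // -ltNye (lt_trans _ bgt0).
Qed.
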